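(* Let $d\ge 1$, let $\mathcal I$ be a finite set of labels, $\eta_0\in\mathcal I$, and let $p_0=\sum_{\eta\in\mathcal I} w_\eta p_\eta$ be a mixture distribution on $\mathbb R^d$ with weights $w_\eta\ge 0$, $\sum_{\eta} w_\eta=1$, $w_{\eta_0}>0$, where each $p_\eta$ is a probability density supported on a convex compact set $K_\eta\subseteq\mathbb R^d$ having at least one interior point, $K_\eta\cap K_{\eta'}=\emptyset$ for all $\eta\neq\eta'$, and $\inf_{x\in K_{\eta_0}}p_{\eta_0}(x)>0$. Let $T>0$ and $\gamma\ge 1$. Then for any starting location $x_0\in\mathbb R^d$ and any solution $(x_t)_{0\le t<T}$ started at $x_0$ of the guided ODE $$\mathrm d x_t=\big(x_t+\nabla\log p_{T-t}(x_t)+\gamma\nabla\log p_{T-t}(\eta_0\mid x_t)\big)\,\mathrm d t,$$ we have $$\lim_{t\to T^-}\operatorname{dist}(x_t,K_{\eta_0})=0 .$$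
   Context: For $t>0$ set $\lambda_t=e^{-t}$, $\sigma_t=\sqrt{1-\lambda_t^2}$, $\phi_t(z)=(\sqrt{2\pi}\,\sigma_t)^{-d}\exp(-\|z\|^2/(2\sigma_t^2))$, and $$p_t(x)=\sum_{\eta\in\mathcal I}w_\eta\int p_\eta(u)\,\phi_t(x-\lambda_t u)\,\mathrm d u,\qquad p_t(\eta_0\mid x)=\frac{w_{\eta_0}\int p_{\eta_0}(u)\,\phi_t(x-\lambda_t u)\,\mathrm d u}{p_t(x)} .$$ (Thus $p_t$ is the law of the Ornstein-Uhlenbeck process $\mathrm d y_t=-y_t\,\mathrm d t+\sqrt2\,\mathrm d W_t$ with $y_0\sim p_0$, and $p_t(\eta_0\mid x)$ is the posterior probability that the label is $\eta_0$ given $y_t=x$.) All gradients are with respect to $x$. $\|\cdot\|$ is the Euclidean norm and $\operatorname{dist}(x,A)=\inf_{y\in A}\|x-y\|$. *)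

(* Defs.v *)
From HB Require Import structures.
From mathcomp Require Import all_boot all_order all_algebra.
From mathcomp Require Import all_classical all_reals all_analysis.
From mathcomp Require Import measurable_realfun.

Set Implicit Arguments.
Unset Strict Implicit.
Unset Printing Implicit Defensive.

Import Order.TTheory GRing.Theory Num.Theory.
Import numFieldNormedType.Exports.

Local Open Scope classical_set_scope.
Local Open Scope ring_scope.

(* ['rV[R]_n] carries the Borel sigma-algebra of its library topology, which is
   the one of the sup norm, hence also that of the Euclidean norm below. *)
HB.instance Definition _ (R : realType) (n : nat) :=
  @isMeasurable.Build (sigma_display (@open 'rV[R]_n)) 'rV[R]_n
    <<s @open 'rV[R]_n >> (@sigma_algebra0 _ setT _) (@sigma_algebraC _ _)
    (@sigma_algebra_bigcup _ setT _).

Section borel_rV.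
Context {R : realType}.

Lemma open_measurable_rV n (U : set 'rV[R]_n) : open U -> measurable U.
Proof. by move=> oU; exact: sub_sigma_algebra. Qed.

Lemma continuous_measurable_rV n (f : 'rV[R]_n -> R) :
  continuous f -> measurable_fun setT f.
Proof.
move=> cf; apply: (measurability _ (RGenOpens.measurableE R)).
move=> _ [_ [a [b ->]] <-].
rewrite setTI; apply: open_measurable_rV.
by apply: open_comp; [move=> x _; exact: cf|exact: interval_open].
Qed.

Lemma measurable_coord n (i : 'I_n) :
  measurable_fun setT (fun v : 'rV[R]_n => v ord0 i).
Proof. by apply: continuous_measurable_rV; exact: coord_continuous. Qed.

Lemma measurable_rVP d (T : measurableType d) n (f : T -> 'rV[R]_n) :
  (forall i, measurable_fun setT (fun t => f t ord0 i)) ->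
  measurable_fun setT f.
Proof.
move=> mf.
have mball (q : 'rV[R]_n) (e : R) : 0 < e -> measurable (f @^-1` ball q e).
  move=> e0; have -> : f @^-1` ball q e =
      \bigcap_(i in [set: 'I_n]) ((fun t => f t ord0 i) @^-1` ball (q ord0 i) e).
    apply/seteqP; split => [t [_ H] i _|t H]; first exact: H.
    by split=> // i j; rewrite ord1; exact: H.
  apply: fin_bigcap_measurable => // i _; rewrite -[X in measurable X]setTI.
  apply: mf => //; apply: open_measurable; exact: ball_open.
apply: (@measurability _ _ _ _ _ _ (@open 'rV[R]_n)) => // _ [U oU <-].
rewrite setTI.
pose c (q : 'rV[rat]_n) : 'rV[R]_n := map_mx ratr q.
pose D := [set qk : 'rV[rat]_n * nat | ball (c qk.1) qk.2.+1%:R^-1 `<=` U].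
have -> : f @^-1` U =
    \bigcup_(qk in D) (f @^-1` ball (c qk.1) qk.2.+1%:R^-1).
  apply/seteqP; split=> [t /= Uft|t [qk Dqk]]; last exact: Dqk.
  have : nbhs (f t) U by exact: open_nbhs_nbhs.
  move=> /nbhs_ballP[e /= e0 eU].
  have [k ke] : exists k, k.+1%:R^-1 < e / 2.
    have := near_infty_natSinv_lt (PosNum (divr_gt0 e0 (ltr0n R 2))).
    by move=> [k _ /(_ k (leqnn k))]; exists k.
  have k0 : 0 < k.+1%:R^-1 :> R by rewrite invr_gt0.
  have qP (i : 'I_n) : exists q : rat, ball (f t ord0 i) k.+1%:R^-1 (ratr q : R).
    have := @dense_rat R (ball (f t ord0 i) k.+1%:R^-1).
    case; [by exists (f t ord0 i); exact: ballxx|exact: ball_open|].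
    by move=> y [bq [q _ qy]]; exists q; rewrite qy.
  have [q qE] := choice qP.
  have cq : ball (f t) k.+1%:R^-1 (c (\row_i q i)).
    by split=> // i j; rewrite ord1 !mxE; exact: qE.
  exists (\row_i q i, k); last exact: ball_sym.
  move=> /= y qy; apply: eU; rewrite (splitr e).
  by apply: (ball_triangle (y := c (\row_i q i)));
    [apply: le_ball cq|apply: le_ball qy]; exact: ltW.
rewrite bigcup_mkcond; apply: countable_bigcupT_measurable.
  exact: countableP.
by move=> [q k]; case: ifPn => // _; apply: mball; rewrite invr_gt0.
Qed.

End borel_rV.

Section lebesgue_rV.
Context {R : realType}.
Local Open Scope ereal_scope.

Definition consrV n (p : R * 'rV[R]_n) : 'rV[R]_n.+1 :=
  \row_i if unlift ord0 i is Some j then p.2 ord0 j else p.1.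

Definition unconsrV n (v : 'rV[R]_n.+1) : R * 'rV[R]_n :=
  (v ord0 ord0, \row_j v ord0 (lift ord0 j)).

Lemma consrVK n : cancel (@consrV n) (@unconsrV n).
Proof.
move=> [a v]; rewrite /unconsrV /consrV !mxE unlift_none; congr pair.
by apply/rowP => j; rewrite !mxE liftK.
Qed.

Lemma measurable_consrV n : measurable_fun setT (@consrV n).
Proof.
apply: measurable_rVP => i; rewrite /consrV; under eq_fun do rewrite mxE.
case: (unlift ord0 i) => [j|]; last exact: measurable_fst.
by apply: (measurableT_comp (@measurable_coord R n j)); exact: measurable_snd.
Qed.

Lemma measurable_unconsrV n : measurable_fun setT (@unconsrV n).
Proof.
apply/measurable_fun_pairP; split; first exact: measurable_coord.
apply: measurable_rVP => i; rewrite /comp/=; under eq_fun do rewrite mxE.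
exact: measurable_coord.
Qed.

Section step.
Variables (n : nat) (m : {sigma_finite_measure set 'rV[R]_n -> \bar R}).

Definition lebesgue_rV_step : set 'rV[R]_n.+1 -> \bar R :=
  pushforward (@lebesgue_measure R \x m) (@consrV n).

Let step0 : lebesgue_rV_step set0 = 0.
Proof. by rewrite /lebesgue_rV_step /pushforward preimage_set0 measure0. Qed.

Let step_ge0 A : 0 <= lebesgue_rV_step A.
Proof. by rewrite /lebesgue_rV_step /pushforward measure_ge0. Qed.

Let mpreimage A : measurable A -> measurable (@consrV n @^-1` A).
Proof.
by move=> mA; rewrite -[X in measurable X]setTI; exact: measurable_consrV.
Qed.

Let step_sigma_additive : semi_sigma_additive lebesgue_rV_step.
Proof.
move=> F mF tF mUF; rewrite /lebesgue_rV_step /pushforward preimage_bigcup.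
apply: measure_semi_sigma_additive.
- by move=> k; exact: mpreimage.
- apply/trivIsetP => /= i j _ _ ij; rewrite -preimage_setI.
  by move/trivIsetP : tF => /(_ _ _ _ _ ij) ->//; rewrite preimage_set0.
- by rewrite -preimage_bigcup; exact: mpreimage.
Qed.

HB.instance Definition _ := isMeasure.Build _ _ _ lebesgue_rV_step
  step0 step_ge0 step_sigma_additive.

Let step_sigma_finite : sigma_finite setT lebesgue_rV_step.
Proof.
have [F FT Foo] : sigma_finite setT (@lebesgue_measure R \x m).
  have /sigma_finiteP[F [TF ndF Foo]] := sigma_finiteT (@lebesgue_measure R).
  have /sigma_finiteP[G [TG ndG Goo]] := sigma_finiteT m.
  exists (fun k => F k `*` G k) => [|k].
    rewrite -setXTT TF TG predeqE => -[x y]; split=> [|[k _ []/= ? ?]].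
      move=> [/= [i _ Fix] [k _ Gky]]; exists (maxn i k) => //; split.
        by move: x Fix; exact/subsetPset/ndF/leq_maxl.
      by move: y Gky; exact/subsetPset/ndG/leq_maxr.
    by split; exists k.
  have [? ?] := Foo k; have [? ?] := Goo k.
  split; first exact: measurableX.
  by rewrite product_measure1E// lte_mul_pinfty// ge0_fin_numE.
exists (fun k => @unconsrV n @^-1` F k).
  by rewrite -preimage_bigcup -FT preimage_setT.
move=> k; have [mF Fk] := Foo k; split.
  by rewrite -[X in measurable X]setTI; exact: measurable_unconsrV.
rewrite /lebesgue_rV_step /pushforward -comp_preimage.
rewrite (_ : _ \o _ = id); last by apply/funext => p /=; exact: consrVK.
by rewrite preimage_id.
Qed.

HB.instance Definition _ := Measure_isSigmaFinite.Build _ _ _ lebesgue_rV_step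
  step_sigma_finite.

End step.

Fixpoint lebesgue_rV (n : nat) : {sigma_finite_measure set 'rV[R]_n -> \bar R} :=
  match n with
  | 0 => @dirac _ 'rV[R]_0 0%R R
  | n'.+1 => lebesgue_rV_step (lebesgue_rV n')
  end.

Lemma lebesgue_rV_box n (A : 'I_n -> set R) : (forall i, measurable (A i)) ->
  lebesgue_rV n [set v | forall i, A i (v ord0 i)] =
  \prod_(i < n) lebesgue_measure (A i).
Proof.
elim: n A => [|n IH] A mA.
  rewrite big_ord0 /= diracE mem_set//=; first by move=> [].
set B := [set v : 'rV[R]_n | forall i, A (lift ord0 i) (v ord0 i)].
have mB : measurable B.
  rewrite (_ : B = \bigcap_(i in [set: 'I_n])
      ((fun v : 'rV[R]_n => v ord0 i) @^-1` A (lift ord0 i))).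
    apply: fin_bigcap_measurable => // i _; rewrite -[X in measurable X]setTI.
    exact: measurable_coord.
  by apply/seteqP; split => [v vA i _|v vA i]; exact: vA.
rewrite big_ord_recl -(IH (fun i => A (lift ord0 i)))//.
rewrite -(product_measure1E lebesgue_measure (lebesgue_rV n) (mA _) mB)/=.
rewrite /lebesgue_rV_step /pushforward; congr (_ _).
apply/seteqP; split => [[a v] /= H|[a v] /= [Ha Hv] i].
  split=> [|i]; first by have := H ord0; rewrite mxE unlift_none.
  by have := H (lift ord0 i); rewrite mxE liftK.
by rewrite mxE; case: unliftP => [j ->|->].
Qed.

End lebesgue_rV.

Section euclidean.
Context {R : realType} {d : nat}.

(* The library norm [`|x|] on ['rV[R]_d] is the sup norm. *)
Definition enorm (x : 'rV[R]_d) : R := Num.sqrt (\sum_i x ord0 i ^+ 2).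

Definition edist_to (x : 'rV[R]_d) (A : set 'rV[R]_d) : R :=
  inf [set enorm (x - y) | y in A].

Definition grad (f : 'rV[R]_d -> R) (x : 'rV[R]_d) : 'rV[R]_d :=
  \row_i 'D_(delta_mx ord0 i) f x.

Definition is_density (p : 'rV[R]_d -> R) : Prop :=
  [/\ measurable_fun setT p, forall x, 0 <= p x
    & (\int[lebesgue_rV d]_x (p x)%:E = 1)%E].

(* At [t = 0] the equation is only asked through continuity of [x] there: for
   a field continuous on [[0, T[], this is the same as asking it with a
   one-sided derivative. *)
Definition ode_solution (v : R -> 'rV[R]_d -> 'rV[R]_d) (T : R)
    (x0 : 'rV[R]_d) (x : R -> 'rV[R]_d) : Prop :=
  [/\ x 0 = x0, {within `[0, T[, continuous x}
    & forall t, 0 < t < T -> is_derive t 1 x (v t (x t))].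

End euclidean.

Section diffusion.
Context {R : realType} {d : nat}.

Definition ou_lambda (t : R) : R := expR (- t).

Definition ou_sigma (t : R) : R := Num.sqrt (1 - ou_lambda t ^+ 2).

Definition ou_phi (t : R) (z : 'rV[R]_d) : R :=
  (Num.sqrt (2 * pi) * ou_sigma t) ^- d *
  expR (- (enorm z ^+ 2 / (2 * ou_sigma t ^+ 2))).

Definition ou_smooth (p : 'rV[R]_d -> R) (t : R) (x : 'rV[R]_d) : R :=
  \int[lebesgue_rV d]_(u in setT) (p u * ou_phi t (x - ou_lambda t *: u)).

Context {I : finType}.
Variables (w : I -> R) (p : I -> 'rV[R]_d -> R).

Definition mix_density (t : R) (x : 'rV[R]_d) : R :=
  \sum_eta w eta * ou_smooth (p eta) t x.

Definition posterior (eta0 : I) (t : R) (x : 'rV[R]_d) : R :=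
  w eta0 * ou_smooth (p eta0) t x / mix_density t x.

Definition guided_drift (eta0 : I) (T gamma t : R) (x : 'rV[R]_d) : 'rV[R]_d :=
  x + grad (fun y => ln (mix_density (T - t) y)) x
    + gamma *: grad (fun y => ln (posterior eta0 (T - t) y)) x.

End diffusion.

(* Main.v *)
Require Import Defs.
From mathcomp Require Import all_boot all_order all_algebra.
From mathcomp Require Import all_classical all_reals all_analysis.
From mathcomp Require Import measurable_realfun ring lra.

(* In the rescaled variable z = x / lambda the guided ODE reads
     dz/dt = - sigma^-2 (z - m0 - (gamma - 1) (m0 - m)),
   where m0 and m are the posterior means of the initial point with and without
   conditioning on the label [eta0]. Let D = dist(z, K0), attained at the
   projection P z. Since m0 lies in the convex set K0, <z - P z, z - m0> >= D^2.
   A mixture point u pulls away from K0 only if it is further from z than D, and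
   at distance > D + e its posterior weight is exponentially small compared with
   that of the part of K0 near P z, whose mass is bounded below by convexity and
   [p_inf]. Hence <z - P z, z - m> <= D^2 + D err with err -> 0 uniformly in z, so
   (D^2)' <= - sigma^-2 (D^2 - O(err^2)), and the divergence of the integral of
   sigma^-2 at T forces D -> 0. *)

Set Implicit Arguments.
Unset Strict Implicit.
Unset Printing Implicit Defensive.

Import Order.TTheory GRing.Theory Num.Theory.
Import numFieldNormedType.Exports.

Local Open Scope classical_set_scope.
Local Open Scope ring_scope.

(** * The Euclidean inner product and norm on row vectors *)

Section inner_product.
Context {R : realType} {d : nat}.
Implicit Types (x y z u v : 'rV[R]_d) (a : R).

Definition dot x y : R := \sum_i x ord0 i * y ord0 i.

Lemma dotC x y : dot x y = dot y x.
Proof. by apply: eq_bigr => i _; rewrite mulrC. Qed.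

Lemma dotDl x y z : dot (x + y) z = dot x z + dot y z.
Proof. by rewrite /dot -big_split; apply: eq_bigr => i _; rewrite mxE mulrDl. Qed.

Lemma dotZl a x y : dot (a *: x) y = a * dot x y.
Proof. by rewrite /dot mulr_sumr; apply: eq_bigr => i _; rewrite mxE mulrA. Qed.

Lemma dotNl x y : dot (- x) y = - dot x y.
Proof. by rewrite -scaleN1r dotZl mulN1r. Qed.

Lemma dotBl x y z : dot (x - y) z = dot x z - dot y z.
Proof. by rewrite dotDl dotNl. Qed.

Lemma dotDr x y z : dot x (y + z) = dot x y + dot x z.
Proof. by rewrite !(dotC x) dotDl. Qed.

Lemma dotBr x y z : dot x (y - z) = dot x y - dot x z.
Proof. by rewrite !(dotC x) dotBl. Qed.

Lemma dotZr a x y : dot x (a *: y) = a * dot x y.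
Proof. by rewrite !(dotC x) dotZl. Qed.

Lemma dot_ge0 x : 0 <= dot x x.
Proof. by apply: sumr_ge0 => i _; rewrite -expr2 sqr_ge0. Qed.

Lemma enormE x : enorm x = Num.sqrt (dot x x).
Proof. by rewrite /enorm /dot; under eq_bigr do rewrite expr2. Qed.

Lemma sqr_enorm x : enorm x ^+ 2 = dot x x.
Proof. by rewrite enormE sqr_sqrtr ?dot_ge0. Qed.

Lemma enorm_ge0 x : 0 <= enorm x.
Proof. by rewrite enormE sqrtr_ge0. Qed.

Lemma enormZ a x : enorm (a *: x) = `|a| * enorm x.
Proof.
by rewrite !enormE dotZl dotZr mulrA -expr2 sqrtrM ?sqr_ge0// sqrtr_sqr.
Qed.

Lemma enormN x : enorm (- x) = enorm x.
Proof. by rewrite -scaleN1r enormZ normrN1 mul1r. Qed.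

Lemma enorm_distC x y : enorm (x - y) = enorm (y - x).
Proof. by rewrite -enormN opprB. Qed.

Lemma enorm0_eq0 x : enorm x = 0 -> x = 0.
Proof.
rewrite enormE => /eqP; rewrite sqrtr_eq0 => x_le0.
have /eqP : dot x x = 0 by apply/eqP; rewrite eq_le x_le0 dot_ge0.
rewrite psumr_eq0 => [|i _]; last by rewrite -expr2 sqr_ge0.
move=> /allP x0; apply/rowP => i; rewrite mxE; apply/eqP.
by rewrite -sqrf_eq0 expr2; apply: x0; rewrite mem_index_enum.
Qed.

(** Cauchy-Schwarz: the squared norm of [enorm y *: x - enorm x *: y] is [2 * (enorm x * enorm y)]
    times the difference of the two sides. Vectors of norm zero are treated apart so that this
    factor can be cancelled. *)
Lemma dot_le_enorm x y : dot x y <= enorm x * enorm y.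
Proof.
have [x0|x0] := eqVneq (enorm x) 0.
  by rewrite x0 (enorm0_eq0 x0) -(scale0r 0) dotZl !mul0r.
have [y0|y0] := eqVneq (enorm y) 0.
  by rewrite y0 (enorm0_eq0 y0) -(scale0r 0) dotZr mul0r mulr0.
have xy0 : 0 < enorm x * enorm y.
  by rewrite mulr_gt0// lt_neqAle eq_sym ?x0 ?y0 enorm_ge0.
have := dot_ge0 (enorm y *: x - enorm x *: y).
rewrite dotBl !dotBr !dotZl !dotZr -!sqr_enorm (dotC y x) => h.
rewrite -subr_ge0 -(pmulr_rge0 _ xy0) -(pmulr_rge0 _ (ltr0n R 2)).
apply: le_trans h _; rewrite le_eqVlt; apply/orP; left; apply/eqP; ring.
Qed.

Lemma ler_enormD x y : enorm (x + y) <= enorm x + enorm y.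
Proof.
rewrite -(@ler_pXn2r _ 2) ?nnegrE ?addr_ge0 ?enorm_ge0//.
rewrite sqr_enorm dotDl !dotDr -!sqr_enorm (dotC y x) sqrrD.
have := dot_le_enorm x y; lra.
Qed.

Lemma continuous_dot (S : topologicalType) (f g : S -> 'rV[R]_d) :
  continuous f -> continuous g -> continuous (fun s => dot (f s) (g s)).
Proof.
move=> cf cg; have h := @continuous_big R 'I_d +%R 0 xpredT (@add_continuous R) S.
apply: (h (index_enum _) (fun i s => f s ord0 i * g s ord0 i)) => i _ s.
apply: continuousM.
  apply: (@continuous_comp _ _ _ f (fun v => v ord0 i)); first exact: cf.
  exact: coord_continuous.
apply: (@continuous_comp _ _ _ g (fun v => v ord0 i)); first exact: cg.
exact: coord_continuous.
Qed.

End inner_product.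

(** * Nearest-point projection onto a convex set *)

Section projection.
Context {R : realType} {d : nat}.
Variable K : set 'rV[R]_d.
Hypothesis K_convex : convex_set (K : set (convex_lmodType 'rV[R]_d)).
Implicit Types x y z k : 'rV[R]_d.

Lemma convex_combination (t : R) x y : 0 <= t <= 1 -> K x -> K y ->
  K (x + t *: (y - x)).
Proof.
move=> /andP[t0 t1] Kx Ky.
have := K_convex (Itv01 t0 t1) (mem_set Ky) (mem_set Kx).
rewrite inE; congr (K _); apply/rowP => i.
by rewrite /conv/= !mxE/= /unstable.onem; ring.
Qed.

(** The obtuse angle criterion, which characterises the nearest point of a convex set. *)
Definition is_projection (P : 'rV[R]_d -> 'rV[R]_d) :=
  forall z, K (P z) /\ forall k, K k -> dot (z - P z) (k - P z) <= 0.

(** Compactness gives a minimiser of the squared distance; moving it along a segment inside [K]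
    gives the obtuse angle inequality. *)
Lemma projection_exists : compact K -> K !=set0 -> exists P, is_projection P.
Proof.
move=> cK K0; suff /choice[P PP] : forall z, exists p,
    K p /\ forall k, K k -> dot (z - p) (k - p) <= 0 by exists P.
move=> z.
have [p] : exists2 p, p \in K &
    forall k, k \in K -> dot (z - p) (z - p) <= dot (z - k) (z - k).
  apply: compact_EVT_min => //; apply: continuous_subspaceT.
  have cz : continuous (fun k => z - k).
    by move=> x; apply: continuousB; [exact: cst_continuous|exact: cvg_id].
  exact: continuous_dot.
rewrite inE => Kp minp; exists p; split => // k Kk.
set u := z - p; set e := k - p; set a := dot u e; rewrite leNgt; apply/negP => a0.
set b := dot e e.
have b0 : 0 <= b by exact: dot_ge0.
have ab0 : 0 < a + b by rewrite ltr_wpDr.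
(* Minimality against this point of the segment gives [2 * a <= t * b], whereas the choice of [t]
   makes [t * b = a - t * a < a]. *)
pose t := a / (a + b).
have t0 : 0 < t by rewrite divr_gt0.
have t1 : t <= 1 by rewrite ler_pdivrMr// mul1r lerDl.
have /minp : p + t *: (k - p) \in K.
  by rewrite inE; apply: convex_combination => //; rewrite (ltW t0).
rewrite opprD addrA -/u -/e.
rewrite (dotBl u) !(dotBr _ u) !dotZl !dotZr (dotC e) -/a -/b => h.
have : 0 <= t * (t * b - 2 * a) by lra.
rewrite pmulr_rge0// => h2.
have : t * b <= b by rewrite ler_piMl.
have : t * (a + b) = a by rewrite /t divfK// gt_eqF.
have : 0 < t * a by rewrite mulr_gt0.
nra.
Qed.

Variable P : 'rV[R]_d -> 'rV[R]_d.
Hypothesis P_proj : is_projection P.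

Lemma proj_le z k : K k -> enorm (z - P z) <= enorm (z - k).
Proof.
move=> Kk; have [_ /(_ _ Kk) h] := P_proj z.
rewrite -(@ler_pXn2r _ 2) ?nnegrE ?enorm_ge0// !sqr_enorm.
have -> : z - k = (z - P z) - (k - P z) by rewrite opprB addrA subrK.
move: (z - P z) (k - P z) h => v e h.
rewrite dotBl !dotBr (dotC e v); have := dot_ge0 e; lra.
Qed.

(** The part [k - P z] of [k - z] has nonpositive product with [z - P z]. The bound is affine in
    [k], so it passes to averages of points of [K]. *)
Lemma proj_dot_ge z k : K k ->
  enorm (z - P z) ^+ 2 <= dot (z - P z) (z - k).
Proof.
move=> Kk; have [_ /(_ _ Kk) h] := P_proj z.
have -> : z - k = (z - P z) - (k - P z) by rewrite opprB addrA subrK.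
by rewrite dotBr sqr_enorm; lra.
Qed.

(* Hence the squared distance is differentiable, with gradient [2 (z - P z)],
   although [P] itself need not be. *)
Lemma sqr_dist_expansion z y :
  `|enorm (y - P y) ^+ 2 - enorm (z - P z) ^+ 2
    - 2 * dot (z - P z) (y - z)| <= enorm (y - z) ^+ 2.
Proof.
have [Kz hz] := P_proj z; have [Ky _] := P_proj y.
(* The upper bound takes [P z] as a competitor for [y]; the lower bound uses the obtuse angle
   inequality at [z] for the point [P y]. *)
rewrite ler_norml; apply/andP; split; last first.
  have := proj_le y Kz.
  rewrite -(@ler_pXn2r _ 2) ?nnegrE ?enorm_ge0// !sqr_enorm.
  have -> : y - P z = (z - P z) + (y - z) by apply/rowP => i; rewrite !mxE; ring.
  move: (y - P y) (z - P z) (y - z) => u v e.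
  by rewrite dotDl !dotDr (dotC e v); lra.
have := hz _ Ky; rewrite !sqr_enorm.
have -> : y - P y = (z - P z) + ((y - z) - (P y - P z)).
  by apply/rowP => i; rewrite !mxE; ring.
move: (z - P z) (y - z) (P y - P z) => v h k vk.
have := dot_ge0 (h - k); have := dot_ge0 h.
by rewrite (dotDl v) !(dotDr _ v) (dotC (h - k) v) (dotBr v h k); lra.
Qed.

End projection.

(** * The Gaussian kernel: positivity, bounds, directional derivatives *)

Section gaussian_kernel.
Context {R : realType} {d : nat}.
Implicit Types (x y z u v : 'rV[R]_d) (t : R).

Lemma ou_lambda_gt0 t : 0 < ou_lambda t.
Proof. exact: expR_gt0. Qed.

Lemma ou_lambda_lt1 t : 0 < t -> ou_lambda t < 1.
Proof. by move=> t0; rewrite /ou_lambda -expR0 ltr_expR oppr_lt0. Qed.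

Lemma sqr_ou_sigma t : 0 < t -> ou_sigma t ^+ 2 = 1 - ou_lambda t ^+ 2.
Proof.
move=> t0; rewrite sqr_sqrtr// subr_ge0 expr_le1// ltW ?ou_lambda_gt0//.
exact: ou_lambda_lt1.
Qed.

Lemma ou_sigma_gt0 t : 0 < t -> 0 < ou_sigma t.
Proof.
move=> t0; rewrite sqrtr_gt0 subr_gt0 expr_lt1//; first exact: ou_lambda_lt1.
exact/ltW/ou_lambda_gt0.
Qed.

Lemma sqr_ou_sigma_lt1 t : 0 < t -> ou_sigma t ^+ 2 < 1.
Proof.
by move=> t0; rewrite sqr_ou_sigma// ltrBlDr ltrDl exprn_gt0// ou_lambda_gt0.
Qed.

Definition phi_cst t : R := (Num.sqrt (2 * pi) * ou_sigma t) ^- d.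

Lemma phi_cst_gt0 t : 0 < t -> 0 < phi_cst t.
Proof.
move=> t0; rewrite invr_gt0 exprn_gt0// mulr_gt0 ?ou_sigma_gt0//.
by rewrite sqrtr_gt0 mulr_gt0// pi_gt0.
Qed.

Lemma ou_phi_gt0 t z : 0 < t -> 0 < ou_phi t z.
Proof. by move=> t0; rewrite mulr_gt0 ?phi_cst_gt0// expR_gt0. Qed.

Lemma ou_phi_le t z : 0 < t -> ou_phi t z <= phi_cst t.
Proof.
move=> t0; rewrite -[leRHS]mulr1 ler_pM2l ?phi_cst_gt0//.
rewrite -expR0 ler_expR oppr_le0 divr_ge0 ?exprn_ge0 ?enorm_ge0//.
by rewrite mulr_ge0// exprn_ge0// ltW// ou_sigma_gt0.
Qed.

(** With $r$ the norm of [z] and $\sigma<1$, $r\le 1+r^2/2\le\exp(r^2/(2\sigma^2))$. This will bound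
    derivatives of the kernel uniformly in the point. *)
Lemma enorm_ou_phi_le t z : 0 < t -> enorm z * ou_phi t z <= phi_cst t.
Proof.
move=> t0; rewrite mulrCA -[leRHS]mulr1 ler_pM2l ?phi_cst_gt0//.
rewrite expRN ler_pdivrMr ?expR_gt0// mul1r.
have s0 : 0 < ou_sigma t ^+ 2 by rewrite exprn_gt0// ou_sigma_gt0.
apply: le_trans (expR_ge1Dx _).
have : enorm z ^+ 2 / 2 <= enorm z ^+ 2 / (2 * ou_sigma t ^+ 2).
  rewrite ler_wpM2l ?exprn_ge0 ?enorm_ge0// lef_pV2 ?posrE//.
    by have := sqr_ou_sigma_lt1 t0; lra.
  by rewrite mulr_gt0.
have := sqr_ge0 (enorm z - 1); nra.
Qed.

Lemma continuous_ou_phi t : continuous (@ou_phi R d t).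
Proof.
have c1 : continuous (fun z : 'rV[R]_d => enorm z ^+ 2).
  under eq_fun do rewrite sqr_enorm.
  by apply: (@continuous_dot _ _ _ id id) => z; exact: cvg_id.
move=> z; have c2 : - (enorm y ^+ 2 / (2 * ou_sigma t ^+ 2)) @[y --> z] -->
    - (enorm z ^+ 2 / (2 * ou_sigma t ^+ 2)).
  exact: cvgN (cvgM (c1 z) (cvg_cst _)).
have c3 := continuous_cvg _ (@continuous_expR R _) c2.
have c4 := cvgM (cvg_cst (phi_cst t)) (c3 _).
exact: c4.
Qed.

Lemma is_derive_ou_phi t y v (h : R) : 0 < t ->
  is_derive h 1 (fun s => ou_phi t (s *: v + y))
    (- (dot v (h *: v + y) / ou_sigma t ^+ 2) * ou_phi t (h *: v + y)).
Proof.
move=> t0; have s0 : ou_sigma t != 0 by rewrite gt_eqF// ou_sigma_gt0.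
(* The exponent along the line, written as a quadratic polynomial in [s] so that the derivative
   rules apply. *)
pose g : R -> R := - ((2 * ou_sigma t ^+ 2)^-1 *:
  (dot v v *: id ^+ 2 + (2 * dot y v) *: id + cst (dot y y))).
have gE s : g s = - (enorm (s *: v + y) ^+ 2 / (2 * ou_sigma t ^+ 2)).
  rewrite /g sqr_enorm dotDl !dotDr !dotZl !dotZr (dotC v y).
  rewrite !fctE /= /GRing.scale/=; congr (- _); rewrite mulrC; congr (_ * _).
  by ring.
have -> : (fun s => ou_phi t (s *: v + y)) = phi_cst t *: (expR \o g).
  by apply/funext => s; rewrite /ou_phi -gE.
have dg : is_derive h 1 g (- (dot v (h *: v + y) / ou_sigma t ^+ 2)).
  apply: is_derive_eq; rewrite dotDr dotZr (dotC y v) /GRing.scale/=.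
  by field.
apply: is_derive_eq.
by rewrite /ou_phi -gE -/(phi_cst t) /GRing.scale/=; ring.
Qed.

End gaussian_kernel.

Arguments phi_cst {R} d t.

Lemma Rintegral_sum (R : realType) disp (T : measurableType disp)
  (mu : {measure set T -> \bar R}) (J : Type) (s : seq J) (f : J -> T -> R) :
  (forall j, mu.-integrable setT (EFin \o f j)) ->
  \int[mu]_(x in setT) (\sum_(j <- s) f j x) =
  \sum_(j <- s) \int[mu]_(x in setT) f j x.
Proof.
move=> intf; rewrite /Rintegral.
rewrite (eq_integral (fun x => \sum_(j <- s) (f j x)%:E)%E); last first.
  by move=> x _; rewrite sumEFin.
rewrite integral_sum//; rewrite -sum_fine// => j _.
exact: (integrable_fin_num _ (intf j)).
Qed.

(** * Integrals against the kernel and differentiation of a smoothed density *)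

Section smoothing.
Context {R : realType} {d : nat}.
Implicit Types (x y z u v : 'rV[R]_d) (t : R) (p q h : 'rV[R]_d -> R).

Definition lebesgue_integrable p :=
  (lebesgue_rV d).-integrable setT (EFin \o p).

Lemma integrable_mul_bounded p h (M : R) : lebesgue_integrable p ->
  measurable_fun setT h -> (forall u, `|h u| <= M) ->
  lebesgue_integrable (fun u => p u * h u).
Proof.
move=> ip mh hM; apply: (@integrableMl _ _ _ _ _ measurableT _ h ip mh).
rewrite /bounded_near; exists M; split; first exact: num_real.
by move=> N MN u _; apply: (le_trans (hM u)); exact: ltW.
Qed.

Lemma integrable_sum_scale (J : finType) (c : J -> R)
    (f : J -> 'rV[R]_d -> R) : (forall j, lebesgue_integrable (f j)) ->
  lebesgue_integrable (fun u => \sum_j c j * f j u).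
Proof.
move=> intf; rewrite /lebesgue_integrable.
rewrite (_ : EFin \o _ = (fun u => \sum_j (c j)%:E * (f j u)%:E)%E); last first.
  by apply/funext => u /=; rewrite -sumEFin; apply: eq_bigr => j _; rewrite EFinM.
by apply: integrable_sum => // j _; exact: integrableZl (intf j).
Qed.

Definition kern t x u : R := ou_phi t (x - ou_lambda t *: u).

Lemma measurable_of_continuous_affine h t x : continuous h ->
  measurable_fun setT (fun u => h (x - ou_lambda t *: u)).
Proof.
move=> ch; apply: continuous_measurable_rV => u.
have c1 : x - ou_lambda t *: u' @[u' --> u] --> x - ou_lambda t *: u.
  exact: cvgB (cvg_cst x) (cvgZ (cvg_cst _) cvg_id).
exact: (cvg_comp _ _ c1 (ch _)).
Qed.

Lemma kern_gt0 t x u : 0 < t -> 0 < kern t x u.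
Proof. exact: ou_phi_gt0. Qed.

Lemma integrable_mul_kern t x p : 0 < t -> lebesgue_integrable p ->
  lebesgue_integrable (fun u => p u * kern t x u).
Proof.
move=> t0 ip; apply: (@integrable_mul_bounded _ _ (phi_cst d t)) => //.
  exact: (measurable_of_continuous_affine _ _ (@continuous_ou_phi R d t)).
by move=> u; rewrite gtr0_norm ?kern_gt0//; exact: ou_phi_le.
Qed.

Lemma norm_dot_kern_le t x u v : 0 < t ->
  `|dot v (x - ou_lambda t *: u) * kern t x u| <= enorm v * phi_cst d t.
Proof.
move=> t0; rewrite /kern; move: (x - _) => y.
rewrite normrM (gtr0_norm (ou_phi_gt0 _ t0)).
apply: (@le_trans _ _ (enorm v * enorm y * ou_phi t y)).
  rewrite ler_pM2r ?ou_phi_gt0// ler_norml dot_le_enorm andbT.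
  by rewrite lerNl -dotNl -(enormN v) dot_le_enorm.
by rewrite -mulrA ler_wpM2l ?enorm_ge0// enorm_ou_phi_le.
Qed.

Lemma integrable_mul_dot_kern t x v p : 0 < t -> lebesgue_integrable p ->
  lebesgue_integrable
    (fun u => p u * (dot v (x - ou_lambda t *: u) * kern t x u)).
Proof.
move=> t0 ip; apply: (@integrable_mul_bounded _ _ (enorm v * phi_cst d t)) => //.
  apply: (@measurable_of_continuous_affine (fun y => dot v y * ou_phi t y)).
  have cd : continuous (fun y => dot v y).
    by apply: (@continuous_dot _ _ _ (cst v) id) => y; [exact: cst_continuous|exact: cvg_id].
  by move=> y; exact: cvgM (cd y) (@continuous_ou_phi _ _ t y).
by move=> u; exact: norm_dot_kern_le.
Qed.

(** Divided by [ou_smooth p t x], this is the inner product of [v] with [x - ou_lambda t *: m],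
    where [m] is the posterior mean of the initial point under the prior [p]. *)
Definition smooth_dot p t v x : R :=
  \int[lebesgue_rV d]_(u in setT)
    (p u * (dot v (x - ou_lambda t *: u) * kern t x u)).

Lemma is_derive_smooth p t v x : 0 < t -> lebesgue_integrable p ->
  is_derive x v (ou_smooth p t) (- (smooth_dot p t v x / ou_sigma t ^+ 2)).
Proof.
move=> t0 ip.
have s0 : 0 < ou_sigma t ^+ 2 by rewrite exprn_gt0// ou_sigma_gt0.
pose f (h : R) u := p u * kern t (h *: v + x) u.
have shift (h : R) u : h *: v + x - ou_lambda t *: u =
  h *: v + (x - ou_lambda t *: u) by rewrite addrA.
have df (h : R) u : is_derive h 1 (f ^~ u)
    (p u * (- (dot v (h *: v + x - ou_lambda t *: u) / ou_sigma t ^+ 2) *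
      kern t (h *: v + x) u)).
  have := is_derive_ou_phi (x - ou_lambda t *: u) v h t0.
  rewrite -shift /f /kern; under [in X in X -> _]eq_fun do rewrite -shift.
  by move=> df; exact: (@is_deriveZ _ _ _ _ (p u)).
have derf (h : R) u : derivable (f ^~ u) h 1 by exact: ex_derive.
have intf (h : R) : lebesgue_integrable (f h).
  exact: integrable_mul_kern.
(* An integrable dominating function independent of [h]: [norm_dot_kern_le] gives the same bound at
   every base point. *)
pose G u := `|p u| * (enorm v * phi_cst d t / ou_sigma t ^+ 2).
have d1E (h : R) u : partial1of2 f h u =
    p u * (- (dot v (h *: v + x - ou_lambda t *: u) / ou_sigma t ^+ 2) *
      kern t (h *: v + x) u).
  by rewrite partial1of2E; exact: derive_val.
have I0 : `]-1, 1[%classic (0 : R) by rewrite /= in_itv/= ltrN10 ltr01.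
have c0 : 0 <= enorm v * phi_cst d t / ou_sigma t ^+ 2.
  by apply: divr_ge0 (ltW s0); rewrite mulr_ge0 ?enorm_ge0// ltW// phi_cst_gt0.
have G0 u : 0 <= G u by rewrite mulr_ge0.
have intG : lebesgue_integrable G.
  apply: (@integrable_mul_bounded (fun u => `|p u|) _
    (enorm v * phi_cst d t / ou_sigma t ^+ 2)) => //.
    exact: integrable_norm.
  by move=> u; rewrite ger0_norm.
have GE (h : R) u : `|partial1of2 f h u| <= G u.
  rewrite d1E normrM /G ler_wpM2l// mulNr normrN mulrAC normrM.
  rewrite (gtr0_norm (_ : 0 < (ou_sigma t ^+ 2)^-1)) ?invr_gt0//.
  by rewrite ler_pM2r ?invr_gt0// norm_dot_kern_le.
have := @cvg_differentiation_under_integral R _ _ (lebesgue_rV d) f setT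
  measurableT 0 (-1) 1 I0 (fun s _ => intf s) (fun s u _ _ => derf s u)
  G G0 intG (fun s u _ _ => GE s u).
have -> : \int[lebesgue_rV d]_(y in setT) partial1of2 f 0 y =
    - (smooth_dot p t v x / ou_sigma t ^+ 2).
  rewrite /smooth_dot -mulNr mulrC mulrN -mulNr -RintegralZl//; last first.
    exact: integrable_mul_dot_kern.
  by apply: eq_Rintegral => u _; rewrite d1E scale0r add0r; ring.
have -> : (fun h : R => h^-1 *: (\int[lebesgue_rV d]_(y in setT) f (h + 0) y -
      \int[lebesgue_rV d]_(y in setT) f 0 y)) =
    (fun h : R => h^-1 *: (ou_smooth p t (h *: v + x) - ou_smooth p t x)).
  by apply/funext => h; rewrite addr0 /f scale0r add0r.
move=> c; apply: DeriveDef; first by apply/cvg_ex; eexists; exact: c.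
exact: (cvg_lim _ c).
Qed.

End smoothing.

(** * The guided drift in terms of posterior means *)

Section guided_field.
Context {R : realType} {d : nat}.
Implicit Types (x y z u v : 'rV[R]_d) (t : R).

(** Restriction to a line turns a directional derivative into one in a real variable, where the
    chain rule with [ln] applies. *)
Lemma is_derive_line (f : 'rV[R]_d -> R) x v df :
  is_derive x v f df <-> is_derive (0 : R) 1 (fun s => f (s *: v + x)) df.
Proof.
have E : 'D_v f x = 'D_1 (fun s : R => f (s *: v + x)) 0.
  rewrite /derive; set g1 := fun h => h^-1 *: _; set g2 := fun h => h^-1 *: _.
  suff -> : g1 = g2 by [].
  by rewrite funeqE /g1 /g2 => h /=; rewrite addr0 scale0r add0r [_%:A]mulr1.
split=> -[df1 <-].
  by apply: DeriveDef; [exact: (derivable1P f x v).1 df1|rewrite E].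
by apply: DeriveDef; [exact: (derivable1P f x v).2 df1|rewrite E].
Qed.

Lemma is_derive_ln (f : 'rV[R]_d -> R) x v df : 0 < f x ->
  is_derive x v f df -> is_derive x v (fun y => ln (f y)) (df / f x).
Proof.
move=> fx0 /is_derive_line dfx; apply/is_derive_line.
have fE : f (0 *: v + x) = f x by rewrite scale0r add0r.
have dln : is_derive (f (0 *: v + x)) 1 (@ln R) (f x)^-1.
  by rewrite fE; exact: is_derive1_ln.
rewrite mulrC.
exact: (@is_derive1_comp R (@ln R) (fun s => f (s *: v + x)) 0 _ _ dln dfx).
Qed.

Lemma dot_sum_delta v y : dot v y = \sum_i v ord0 i * dot (delta_mx ord0 i) y.
Proof.
apply: eq_bigr => i _; congr (_ * _); rewrite /dot (bigD1 i)//= big1 ?addr0.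
  by rewrite mxE !eqxx mul1r.
by move=> j ji; rewrite mxE (negPf ji) andbF mul0r.
Qed.

(** [grad] is built from partial derivatives, and this linearity in [v] reassembles its inner
    product with [v]. *)
Lemma smooth_dot_sum (p : 'rV[R]_d -> R) t v x : 0 < t ->
  lebesgue_integrable p ->
  smooth_dot p t v x =
  \sum_i v ord0 i * smooth_dot p t (delta_mx ord0 i) x.
Proof.
move=> t0 ip; rewrite /smooth_dot.
pose f i u := v ord0 i * (p u * (dot (delta_mx ord0 i) (x - ou_lambda t *: u)
  * kern t x u)).
transitivity (\int[lebesgue_rV d]_(u in setT) \sum_i f i u).
  apply: eq_Rintegral => u _; rewrite [in LHS]dot_sum_delta mulr_suml mulr_sumr.
  by apply: eq_bigr => i _; rewrite /f; ring.
rewrite Rintegral_sum; last first.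
  move=> i.
  exact: (integrableZl measurableT _ (integrable_mul_dot_kern x _ t0 ip)).
by apply: eq_bigr => i _; rewrite RintegralZl//; exact: integrable_mul_dot_kern.
Qed.

Lemma grad_coord (f : 'rV[R]_d -> R) x i :
  grad f x ord0 i = 'D_(delta_mx ord0 i) f x.
Proof. by rewrite mxE. Qed.

Variables (I : finType) (w : I -> R) (p : I -> 'rV[R]_d -> R) (eta0 : I).
Hypothesis p_int : forall eta, lebesgue_integrable (p eta).

Definition mixture u : R := \sum_eta w eta * p eta u.

Lemma mixture_integrable : lebesgue_integrable mixture.
Proof. exact: integrable_sum_scale. Qed.

(** Smoothing is linear in the density, so the mixture can be handled as a single density. *)
Lemma mix_densityE t x : 0 < t -> mix_density w p t x = ou_smooth mixture t x.
Proof.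
move=> t0; pose f eta u := w eta * (p eta u * kern t x u).
transitivity (\int[lebesgue_rV d]_(u in setT) \sum_eta f eta u).
  rewrite Rintegral_sum => [|eta].
    by apply: eq_bigr => eta _; rewrite RintegralZl//; exact: integrable_mul_kern.
  exact: (integrableZl measurableT _ (integrable_mul_kern x t0 (p_int eta))).
apply: eq_Rintegral => u _; rewrite /mixture mulr_suml.
by apply: eq_bigr => eta _; rewrite /f mulrA.
Qed.

(** The log posterior is a constant plus $\log q_0-\log q$, with $q_0$ and $q$ the smoothed [p eta0]
    and [mixture]. The drift is thus $x+\gamma\nabla\log q_0-(\gamma-1)\nabla\log q$, and
    [is_derive_smooth] gives both gradients. *)
Lemma dot_guided_drift (T gamma t : R) v x : 0 < T - t -> 0 < w eta0 ->
  (forall y, 0 < ou_smooth (p eta0) (T - t) y) ->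
  (forall y, 0 < ou_smooth mixture (T - t) y) ->
  dot v (guided_drift w p eta0 T gamma t x) = dot v x -
    (gamma * (smooth_dot (p eta0) (T - t) v x / ou_smooth (p eta0) (T - t) x)
     - (gamma - 1) * (smooth_dot mixture (T - t) v x /
                      ou_smooth mixture (T - t) x)) / ou_sigma (T - t) ^+ 2.
Proof.
rewrite /guided_drift; set s := T - t => s0 w0 q0_gt0 q_gt0.
set q0 := ou_smooth (p eta0) s in q0_gt0 *.
set q := ou_smooth mixture s in q_gt0 *.
have sg0 : ou_sigma s != 0 by rewrite gt_eqF// ou_sigma_gt0.
have -> : (fun y => ln (mix_density w p s y)) = (fun y => ln (q y)).
  by apply/funext => y; rewrite mix_densityE.
have -> : (fun y => ln (posterior w p eta0 s y)) =
    (fun y => ln (w eta0) + ln (q0 y) - ln (q y)).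
  apply/funext => y; rewrite /posterior mix_densityE// -/q -/q0.
  by rewrite ln_div ?posrE ?mulr_gt0// lnM ?posrE.
have Dq i := is_derive_ln (q_gt0 x)
  (is_derive_smooth (delta_mx ord0 i) x s0 mixture_integrable).
have Dq0 i := is_derive_ln (q0_gt0 x)
  (is_derive_smooth (delta_mx ord0 i) x s0 (p_int eta0)).
pose e i : 'rV[R]_d := delta_mx ord0 i.
have Gq i : grad (fun y => ln (q y)) x ord0 i =
    - (smooth_dot mixture s (e i) x / ou_sigma s ^+ 2) / q x.
  by rewrite grad_coord; apply: derive_val.
have Gp i : grad (fun y => ln (w eta0) + ln (q0 y) - ln (q y)) x ord0 i =
    - (smooth_dot (p eta0) s (e i) x / ou_sigma s ^+ 2) / q0 x
    + smooth_dot mixture s (e i) x / ou_sigma s ^+ 2 / q x.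
  rewrite grad_coord.
  have D := is_deriveB (is_deriveD (is_derive_cst (ln (w eta0)) x (e i)) (Dq0 i))
    (Dq i).
  by rewrite (@derive_val _ _ _ _ _ _ _ D) add0r; congr (_ + _); rewrite mulNr opprK.
rewrite (smooth_dot_sum _ _ s0 (p_int _)) (smooth_dot_sum _ _ s0 mixture_integrable).
rewrite !(mulr_suml, mulr_sumr) -sumrB mulr_suml -sumrB; apply: eq_bigr => i _.
rewrite !mxE -!grad_coord Gq Gp -/(e i).
have := lt0r_neq0 (q0_gt0 x); have := lt0r_neq0 (q_gt0 x) => *.
by field; apply/and3P.
Qed.

End guided_field.

(** * Boxes of uniform volume inside a convex set *)

Section boxes.
Context {R : realType} {d : nat}.
Implicit Types (x y z u v k : 'rV[R]_d).

Lemma box_measurable (A : 'I_d -> set R) : (forall i, measurable (A i)) ->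
  measurable [set u : 'rV[R]_d | forall i, A i (u ord0 i)].
Proof.
move=> mA; rewrite (_ : [set u | _] = \bigcap_(i in [set: 'I_d])
    ((fun v : 'rV[R]_d => v ord0 i) @^-1` A i)).
  apply: fin_bigcap_measurable => // i _; rewrite -[X in measurable X]setTI.
  exact: measurable_coord.
by apply/seteqP; split => [v vA i _|v vA i]; exact: vA.
Qed.

(* Shrinking towards [k] a box contained in [K] gives boxes near [k] whose
   volume does not depend on [k]. *)
Lemma convex_box_near (K : set 'rV[R]_d) (M delta : R) :
  convex_set (K : set (convex_lmodType 'rV[R]_d)) -> K° !=set0 -> 0 < M ->
  (forall x y, K x -> K y -> enorm (x - y) <= M) -> 0 < delta ->
  exists2 V : R, 0 < V & forall k, K k -> exists B : set 'rV[R]_d,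
    [/\ measurable B, lebesgue_rV d B = V%:E, B `<=` K &
        forall u, B u -> enorm (u - k) <= delta].
Proof.
move=> cK [c]; rewrite /interior => /nbhs_ballP[r /= r0 cr] M0 KM d0.
(* At most 1, so that shrinking by [th] stays in [K], and with [th * M <= delta], so that the shrunk
   box is close to [k]. *)
pose th := delta / (delta + M).
have dM0 : 0 < delta + M by rewrite addr_gt0.
have th0 : 0 < th by rewrite divr_gt0.
have th1 : th <= 1 by rewrite ler_pdivrMr// mul1r lerDl ltW.
exists ((th * r) ^+ d); first by rewrite exprn_gt0// mulr_gt0.
move=> k Kk; pose m i := k ord0 i + th * (c ord0 i - k ord0 i).
(* Library balls are those of the sup norm; half the radius puts the closed box, expanded back by
   [th^-1], inside the open ball of radius [r] about [c]. *)
pose A i := `[m i - th * (r / 2), m i + th * (r / 2)]%classic.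
have BK u : (forall i, A i (u ord0 i)) ->
    exists2 y, K y & u = k + th *: (y - k).
  move=> Au; exists (k + th^-1 *: (u - k)); last first.
    by apply/rowP => i; rewrite !mxE; field; rewrite gt_eqF.
  apply: cr; split => // i j; rewrite ord1 !mxE.
  have := Au j; rewrite /A /= in_itv/= /m => /andP[h1 h2].
  rewrite /ball/= -(ltr_pM2l th0) -{1}(gtr0_norm th0) -normrM ltr_norml.
  have -> : th * (c ord0 j - (k ord0 j + th^-1 * (u ord0 j - k ord0 j))) =
    th * (c ord0 j - k ord0 j) - (u ord0 j - k ord0 j).
    by field; rewrite gt_eqF.
  have : 0 < th * r by rewrite mulr_gt0.
  by rewrite mulrA in h1 h2; move=> ?; apply/andP; split; lra.
exists [set u | forall i, A i (u ord0 i)]; split.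
- by apply: box_measurable => i; exact: measurable_itv.
- rewrite lebesgue_rV_box => [|i]; last exact: measurable_itv.
  rewrite (eq_bigr (fun=> (th * r)%:E)) => [|i _].
    by rewrite prodEFin prodr_const card_ord.
  have thr : 0 < th * (r / 2) by rewrite mulr_gt0// divr_gt0.
  rewrite lebesgue_measure_itv/= lte_fin ifT; last by lra.
  by rewrite -EFinD; congr (_%:E); field.
- by move=> u /BK[y Ky ->]; apply: convex_combination => //; rewrite ltW.
- move=> u /BK[y Ky ->]; rewrite addrC addKr enormZ gtr0_norm//.
  apply: le_trans (_ : th * M <= _); first by rewrite ler_pM2l// KM.
  by rewrite /th mulrAC ler_pdivrMr// ler_pM2l// lerDr ltW.
Qed.

End boxes.

(** * Kernel estimates around the rescaled point and their integrated forms *)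

Section estimates.
Context {R : realType} {d : nat}.
Implicit Types (x y z u v k : 'rV[R]_d) (t r : R) (p : 'rV[R]_d -> R).

(* The kernel at [x] as a function of the distance [r] from [u] to the rescaled
   point [x / ou_lambda t]. *)
Definition radial_kern t r : R :=
  phi_cst d t * expR (- ((ou_lambda t * r) ^+ 2 / (2 * ou_sigma t ^+ 2))).

Definition rescale t x : 'rV[R]_d := (ou_lambda t)^-1 *: x.

Lemma sub_rescale t x u :
  x - ou_lambda t *: u = ou_lambda t *: (rescale t x - u).
Proof.
by rewrite scalerBr /rescale scalerA divff ?scale1r// gt_eqF// ou_lambda_gt0.
Qed.

Lemma kernE t x u : kern t x u = radial_kern t (enorm (rescale t x - u)).
Proof.
rewrite /kern /ou_phi -/(phi_cst d t) sub_rescale enormZ.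
by rewrite (gtr0_norm (ou_lambda_gt0 _)).
Qed.

Lemma radial_kern_gt0 t r : 0 < t -> 0 < radial_kern t r.
Proof. by move=> t0; rewrite mulr_gt0 ?expR_gt0// phi_cst_gt0. Qed.

Lemma radial_kern_anti t r r' : 0 < t -> 0 <= r <= r' ->
  radial_kern t r' <= radial_kern t r.
Proof.
move=> t0 /andP[r0 rr']; rewrite ler_pM2l ?phi_cst_gt0// ler_expR lerN2.
rewrite ler_pM2r ?invr_gt0 ?mulr_gt0 ?exprn_gt0 ?ou_sigma_gt0//.
rewrite ler_pXn2r ?nnegrE ?mulr_ge0 ?(ltW (ou_lambda_gt0 _))//.
  by rewrite ler_pM2l ?ou_lambda_gt0.
exact: le_trans rr'.
Qed.

(** The two exponents differ by at least $a=(\lambda e)^2/(4\sigma^2)$, and $\exp(-a)\le 1/a$. The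
    factor $1/a$ is a multiple of $\sigma^2/\lambda^2$, which vanishes as $t\to 0$. *)
Lemma radial_kern_ratio t r e : 0 < t -> 0 <= r -> 0 < e ->
  radial_kern t (r + e) <=
  4 * ou_sigma t ^+ 2 / (ou_lambda t * e) ^+ 2 * radial_kern t (r + e / 2).
Proof.
move=> t0 r0 e0.
have l0 := ou_lambda_gt0 t.
have s0 : 0 < ou_sigma t ^+ 2 by rewrite exprn_gt0// ou_sigma_gt0.
set a := (ou_lambda t * e) ^+ 2 / (4 * ou_sigma t ^+ 2).
have a0 : 0 < a.
  by apply: divr_gt0; [apply: exprn_gt0; exact: mulr_gt0|exact: mulr_gt0].
have -> : 4 * ou_sigma t ^+ 2 / (ou_lambda t * e) ^+ 2 = a^-1.
  by rewrite /a invf_div.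
apply: (@le_trans _ _ (expR (- a) * radial_kern t (r + e / 2))); last first.
  rewrite ler_pM2r ?radial_kern_gt0// expRN lef_pV2 ?posrE ?expR_gt0//.
  by apply: le_trans (expR_ge1Dx _); rewrite lerDr.
rewrite /radial_kern (mulrCA (expR _)) ler_pM2l ?phi_cst_gt0// -expRD ler_expR -opprD lerN2.
rewrite -subr_ge0; set b := (X in 0 <= X).
have -> : b = ou_lambda t ^+ 2 / (2 * ou_sigma t ^+ 2) *
    ((r + e) ^+ 2 - (r + e / 2) ^+ 2 - e ^+ 2 / 2).
  by rewrite /b /a; field; rewrite gt_eqF// ou_sigma_gt0.
apply: mulr_ge0; first exact: divr_ge0 (sqr_ge0 _) (mulr_ge0 _ (ltW s0)).
have : 0 <= r * e by rewrite mulr_ge0// ltW.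
have : 0 <= e ^+ 2 by rewrite sqr_ge0.
nra.
Qed.

Lemma le_smooth p (q : 'rV[R]_d -> R) t x : 0 < t -> lebesgue_integrable p ->
  lebesgue_integrable q -> (forall u, p u <= q u) ->
  ou_smooth p t x <= ou_smooth q t x.
Proof.
move=> t0 ip iq pq; apply: le_Rintegral => //; first exact: integrable_mul_kern.
  exact: integrable_mul_kern.
by move=> u _; rewrite ler_pM2r ?ou_phi_gt0.
Qed.

Lemma smoothZ (a : R) p t x : 0 < t -> lebesgue_integrable p ->
  ou_smooth (fun u => a * p u) t x = a * ou_smooth p t x.
Proof.
move=> t0 ip; rewrite -RintegralZl//; last exact: integrable_mul_kern.
by apply: eq_Rintegral => u _; rewrite mulrA.
Qed.

(** Only the mass on [B] is kept: there the density is at least [c], and by the triangle inequality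
    the kernel is at least its value at the stated radius. *)
Lemma smooth_ge p t x k (B : set 'rV[R]_d) (c V delta : R) : 0 < t ->
  lebesgue_integrable p -> (forall u, 0 <= p u) -> 0 <= delta -> 0 <= c ->
  measurable B -> lebesgue_rV d B = V%:E ->
  (forall u, B u -> c <= p u /\ enorm (u - k) <= delta) ->
  c * V * radial_kern t (enorm (rescale t x - k) + delta) <= ou_smooth p t x.
Proof.
move=> t0 ip p0 d0 c0 mB BV Bc; set g := radial_kern _ _.
have g0 : 0 < g by rewrite radial_kern_gt0.
have intB : (\int[lebesgue_rV d]_u (\1_B u)%:E = V%:E)%E.
  by rewrite integral_indic// setIT; exact: BV.
have iB : lebesgue_integrable (\1_B : 'rV[R]_d -> R).
  apply/integrableP; split; first exact/measurable_EFinP/measurable_indic.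
  under eq_integral => u _ do rewrite /= ger0_norm//.
  by rewrite intB ltry.
have -> : c * V * g = \int[lebesgue_rV d]_(u in setT) (c * g * \1_B u).
  rewrite RintegralZl// /Rintegral intB/=.
  by ring.
apply: le_Rintegral => //.
- exact: (integrableZl measurableT _ iB).
- exact: integrable_mul_kern.
move=> u _; rewrite indicE; have [|] := boolP (u \in B); last first.
  by move=> _; rewrite mulr0 mulr_ge0// ltW// ou_phi_gt0.
rewrite inE mulr1 => /Bc[cp uk]; apply: ler_pM => //; first exact: ltW.
rewrite -/(kern t x u) kernE; apply: radial_kern_anti => //.
rewrite enorm_ge0/=; apply: le_trans (_ : enorm (rescale t x - k) + enorm (u - k) <= _).
  rewrite (enorm_distC u) (_ : rescale t x - u = rescale t x - k + (k - u)).
    exact: ler_enormD.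
  by rewrite addrA subrK.
by rewrite lerD2l.
Qed.

(** A half-space containing the support of [p] contains the posterior mean. *)
Lemma smooth_dot_ge p t v x (a : R) : 0 < t -> lebesgue_integrable p ->
  (forall u, 0 <= p u) ->
  (forall u, p u != 0 -> a <= dot v (rescale t x - u)) ->
  ou_lambda t * a * ou_smooth p t x <= smooth_dot p t v x.
Proof.
move=> t0 ip p0 pa; rewrite -RintegralZl//; last exact: integrable_mul_kern.
apply: le_Rintegral => //.
- exact: (integrableZl measurableT _ (integrable_mul_kern x t0 ip)).
- exact: integrable_mul_dot_kern.
move=> u _; rewrite -/(kern t x u).
have [->|pu] := eqVneq (p u) 0; first by rewrite !mul0r mulr0.
rewrite sub_rescale dotZr mulrCA ler_wpM2l// ler_pM2r ?kern_gt0//.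
by rewrite ler_pM2l ?ou_lambda_gt0// pa.
Qed.

(* The mass at distance more than [enorm v + e] from the rescaled point is damped
   by the kernel and gives the second term, the rest gives the first one. *)
Lemma smooth_dot_le p t v x (M e : R) : 0 < t -> 0 < e -> 0 <= M ->
  lebesgue_integrable p -> (forall u, 0 <= p u) ->
  (forall u, p u != 0 -> enorm (rescale t x - u) <= enorm v + M) ->
  smooth_dot p t v x <=
  ou_lambda t * (enorm v * (enorm v + e) * ou_smooth p t x +
    enorm v * M * radial_kern t (enorm v + e) *
    \int[lebesgue_rV d]_(u in setT) p u).
Proof.
move=> t0 e0 M0 ip p0 pM; set D := enorm v; set g := radial_kern _ _.
have g0 : 0 < g by rewrite radial_kern_gt0.
have l0 := ou_lambda_gt0 t.
have D0 : 0 <= D by rewrite enorm_ge0.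
have ik := integrable_mul_kern x t0 ip.
pose f1 u := D * (D + e) * (p u * kern t x u).
pose f2 u := D * M * g * p u.
have i1 : lebesgue_integrable f1 := integrableZl measurableT _ ik.
have i2 : lebesgue_integrable f2 := integrableZl measurableT _ ip.
have iD : lebesgue_integrable (fun u => f1 u + f2 u) :=
  integrableD measurableT i1 i2.
rewrite [leRHS](_ : _ =
    \int[lebesgue_rV d]_(u in setT) (ou_lambda t * (f1 u + f2 u))); last first.
  by rewrite RintegralZl// RintegralD// !RintegralZl.
apply: le_Rintegral => //.
- exact: integrable_mul_dot_kern.
- exact: (integrableZl measurableT _ iD).
move=> u _; rewrite -/(kern t x u).
have [pu0|pu] := eqVneq (p u) 0; first by rewrite /f1 /f2 pu0 !(mul0r, mulr0) addr0 mulr0.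
rewrite sub_rescale dotZr [leRHS](_ : _ = p u * (ou_lambda t *
  (D * (D + e) * kern t x u + D * M * g))); last by rewrite /f1 /f2; ring.
rewrite ler_wpM2l// -mulrA ler_pM2l//.
have k0 := kern_gt0 x u t0; set a := enorm (rescale t x - u).
have va : dot v (rescale t x - u) <= D * a by exact: dot_le_enorm.
have [ae|ea] := leP a (D + e).
  apply: ler_wpDr; first exact: mulr_ge0 (mulr_ge0 D0 M0) (ltW g0).
  by rewrite ler_pM2r//; apply: (le_trans va); rewrite ler_wpM2l.
have kg : kern t x u <= g.
  rewrite kernE; apply: radial_kern_anti => //.
  by rewrite addr_ge0 ?(ltW e0)// ltW.
(* For a far point, [D + M] is at most [(D + e) + M]: the first part is charged to the first term,
   and the damped kernel is used only for the excess [D * M]. *)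
apply: (@le_trans _ _ ((D * (D + e) + D * M) * kern t x u)).
  rewrite ler_pM2r//; apply: (le_trans va); rewrite -mulrDr ler_wpM2l//.
  by apply: (le_trans (pM u pu)); rewrite -/D lerD2r lerDl ltW.
by rewrite mulrDl lerD2l ler_wpM2l// mulr_ge0.
Qed.

End estimates.

Arguments radial_kern {R} d t r.

(** * Contraction towards [K], for a component [p] living on [K] and a density [q] dominating a
    multiple of it *)

Section contraction.
Context {R : realType} {d : nat}.
Implicit Types (x y z u v k : 'rV[R]_d) (t : R).

Variables (K : set 'rV[R]_d) (P : 'rV[R]_d -> 'rV[R]_d).
Variables (p q : 'rV[R]_d -> R) (c w0 M : R).
Hypothesis K_convex : convex_set (K : set (convex_lmodType 'rV[R]_d)).
Hypothesis K_interior : K° !=set0.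
Hypothesis P_proj : is_projection K P.
Hypothesis c_gt0 : 0 < c.
Hypothesis w0_gt0 : 0 < w0.
Hypothesis M_gt0 : 0 < M.
Hypothesis p_int : lebesgue_integrable p.
Hypothesis p_ge0 : forall u, 0 <= p u.
Hypothesis p_supp : forall u, p u != 0 -> K u.
Hypothesis p_ge : forall u, K u -> c <= p u.
Hypothesis q_int : lebesgue_integrable q.
Hypothesis q_ge : forall u, w0 * p u <= q u.
Hypothesis q_supp : forall k u, K k -> q u != 0 -> enorm (u - k) <= M.

Let q_ge0 u : 0 <= q u.
Proof. by apply: le_trans (q_ge u); rewrite mulr_ge0// ltW. Qed.

(** On [K] the density [q] is at least [w0 * c > 0], so [q_supp] applies to points of [K]
    themselves. *)
Lemma support_diameter x y : K x -> K y -> enorm (x - y) <= M.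
Proof.
move=> Kx Ky; apply: q_supp => //; rewrite gt_eqF//.
by apply: lt_le_trans (q_ge x); rewrite mulr_gt0// (lt_le_trans c_gt0)// p_ge.
Qed.

(** The mass of [p] in a box near the projection suffices. What matters is that [V] depends on
    neither [t] nor [x]. *)
Lemma smooth_lower_bound (delta : R) : 0 < delta ->
  exists2 V : R, 0 < V & forall t x, 0 < t ->
  V * radial_kern d t (enorm (rescale t x - P (rescale t x)) + delta)
    <= ou_smooth p t x.
Proof.
move=> d0.
have [V V0 VB] := convex_box_near K_convex K_interior M_gt0 support_diameter d0.
exists (c * V) => [|t x t0]; first exact: mulr_gt0.
set z := rescale t x; have [Kz _] := P_proj z.
have [B [mB BV BK Bd]] := VB _ Kz.
apply: (smooth_ge x t0 p_int p_ge0 (ltW d0) (ltW c_gt0) mB BV) => u Bu.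
by split; [exact/p_ge/BK|exact: Bd].
Qed.

Lemma smooth_gt0 t x : 0 < t -> 0 < ou_smooth p t x.
Proof.
move=> t0; have [V V0 /(_ t x t0)] := smooth_lower_bound ltr01.
by apply: lt_le_trans; rewrite mulr_gt0// radial_kern_gt0.
Qed.

Lemma smooth_dominated t x : 0 < t -> w0 * ou_smooth p t x <= ou_smooth q t x.
Proof.
move=> t0; rewrite -smoothZ//; apply: le_smooth => //.
exact: (integrableZl measurableT _ p_int).
Qed.

Lemma smooth_dominating_gt0 t x : 0 < t -> 0 < ou_smooth q t x.
Proof.
move=> t0; apply: lt_le_trans (smooth_dominated x t0).
by rewrite mulr_gt0// smooth_gt0.
Qed.

(** With $D$ the norm of [v], the quotient for [p] is at least $\lambda D^2$ and the one for [q] at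
    most $\lambda(D^2+D\cdot\mathrm{error})$. The weights [gamma] and [gamma - 1] differ by one, so
    exactly one $D^2$ survives. *)
Lemma guided_contraction (gamma e : R) : 1 <= gamma -> 0 < e ->
  exists2 A : R, 0 <= A & forall t x v, 0 < t ->
  v = rescale t x - P (rescale t x) ->
  ou_lambda t * (enorm v ^+ 2 - (gamma - 1) * enorm v *
    (e + A * (ou_sigma t ^+ 2 / ou_lambda t ^+ 2))) <=
  gamma * (smooth_dot p t v x / ou_smooth p t x) -
  (gamma - 1) * (smooth_dot q t v x / ou_smooth q t x).
Proof.
(* The mass is bounded below at margin [e / 2] and the far points lie beyond margin [e]; this gap is
   what [radial_kern_ratio] exploits. *)
move=> g1 e0; have e20 : 0 < e / 2 by rewrite divr_gt0.
have [V V0 VP] := smooth_lower_bound e20.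
set m := \int[lebesgue_rV d]_(u in setT) q u.
have m0 : 0 <= m by apply: Rintegral_ge0 => u _; exact: q_ge0.
(* This is [M * m / (w0 * V)] times the kernel ratio, with $\sigma^2/\lambda^2$ factored out. *)
exists (4 * M * m / (e ^+ 2 * (w0 * V))) => [|t x v t0].
  by rewrite divr_ge0 ?mulr_ge0// ?(ltW M_gt0)// ?sqr_ge0// ltW.
set z := rescale t x => vE.
have l0 := ou_lambda_gt0 t.
have s0 : 0 < ou_sigma t ^+ 2 by rewrite exprn_gt0// ou_sigma_gt0.
have p0 := smooth_gt0 x t0; have q0 := smooth_dominating_gt0 x t0.
have [Kz _] := P_proj z.
have D0 : 0 <= enorm v := enorm_ge0 v.
have lowp : ou_lambda t * enorm v ^+ 2 <= smooth_dot p t v x / ou_smooth p t x.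
  rewrite ler_pdivlMr//; apply: smooth_dot_ge => // u pu.
  by rewrite vE; exact: proj_dot_ge (p_supp pu).
have G0 : 0 < radial_kern d t (enorm v + e / 2) by rewrite radial_kern_gt0.
have GQ : w0 * V * radial_kern d t (enorm v + e / 2) <= ou_smooth q t x.
  apply: le_trans (smooth_dominated x t0).
  by rewrite -mulrA ler_pM2l// vE; exact: VP.
set r := 4 * ou_sigma t ^+ 2 / (ou_lambda t * e) ^+ 2.
have r0 : 0 <= r by rewrite divr_ge0 ?sqr_ge0// mulr_ge0// ltW.
have GG : radial_kern d t (enorm v + e) <= r / (w0 * V) * ou_smooth q t x.
  apply: le_trans (radial_kern_ratio t0 D0 e0) _; rewrite -/r.
  rewrite -mulrA ler_wpM2l//.
  by rewrite [leRHS]mulrC ler_pdivlMr ?mulr_gt0// [leLHS]mulrC.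
have uppq : smooth_dot q t v x / ou_smooth q t x <=
    ou_lambda t * (enorm v * (enorm v + e) + enorm v * M * (r / (w0 * V)) * m).
  rewrite ler_pdivrMr//.
  have up := @smooth_dot_le _ _ q t v x M e t0 e0 (ltW M_gt0) q_int q_ge0.
  apply: (le_trans (up _)).
    move=> u qu; rewrite (_ : rescale t x - u = v + (P z - u)); last first.
      by rewrite vE addrA subrK.
    by apply: le_trans (ler_enormD _ _) _; rewrite lerD2l enorm_distC q_supp.
  rewrite -(mulrA (ou_lambda t)) ler_pM2l// mulrDl lerD2l -/m.
  have : enorm v * M * radial_kern d t (enorm v + e) <=
     enorm v * M * (r / (w0 * V) * ou_smooth q t x).
    by rewrite ler_wpM2l// mulr_ge0// ltW.
  move=> /(ler_wpM2r m0) h; apply: (le_trans h).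
  by rewrite le_eqVlt; apply/orP; left; apply/eqP; ring.
have g0 : 0 <= gamma by apply: le_trans g1.
have g10 : 0 <= gamma - 1 by rewrite subr_ge0.
have := ler_wpM2l g0 lowp; have := ler_wpM2l g10 uppq.
set X := smooth_dot q _ _ _ / _; set Y := smooth_dot p _ _ _ / _.
rewrite (_ : enorm v * M * (r / (w0 * V)) * m =
  enorm v * (4 * M * m / (e ^+ 2 * (w0 * V)) *
  (ou_sigma t ^+ 2 / ou_lambda t ^+ 2))); last first.
  by rewrite /r; field; rewrite !gt_eqF.
move: (4 * M * m / _ * _) => E; move: (enorm v) => D; lra.
Qed.

End contraction.

(** * A Gronwall comparison with a rate that is not integrable at [T] *)

Section comparison.
Context {R : realType}.
Implicit Types (f g N : R -> R) (t : R).

(** Both functions vanish at [t], so the difference quotients of [g] are bounded by those of [N]. *)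
Lemma is_derive0_squeeze g N t : (forall s, `|g s| <= N s) -> N t = 0 ->
  is_derive t 1 N 0 -> is_derive t 1 g 0.
Proof.
move=> gN Nt [dN N0].
have gt0 : g t = 0 by apply/eqP; rewrite -normr_le0 -Nt.
have cN : h^-1 *: (N (h *: 1 + t) - N t) @[h --> 0^'] --> (0 : R).
  move: dN => /cvg_ex[l cl].
  have l0 : l = 0 by rewrite -N0 /derive (cvg_lim _ cl).
  by rewrite l0 in cl; exact: cl.
have cg : h^-1 *: (g (h *: 1 + t) - g t) @[h --> 0^'] --> (0 : R).
  apply: norm_cvg0.
  have cN' : `|h^-1 *: (N (h *: 1 + t) - N t)| @[h --> 0^'] --> (0 : R).
    have cn := cvg_norm cN; rewrite normr0 in cn; exact: cn.
  apply: (squeeze_cvgr _ (cvg_cst 0) cN'); apply: nearW => h.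
  rewrite normr_ge0/= gt0 Nt !subr0 !normrZ ler_wpM2l//.
  exact: le_trans (gN _) (ler_norm _).
apply: DeriveDef; first by apply/cvg_ex; exists 0; exact: cg.
exact: (cvg_lim _ cg).
Qed.

(* This is [sigma^2 / lambda^2] at time [T - t]. *)
Definition remaining_tau (T t : R) : R := expR (2 * (T - t)) - 1.

Lemma remaining_tau_gt0 T t : t < T -> 0 < remaining_tau T t.
Proof. by move=> tT; rewrite subr_gt0 expR_gt1 mulr_gt0// subr_gt0. Qed.

Lemma is_derive_remaining_tau (T t : R) :
  is_derive t 1 (remaining_tau T) (- 2 * expR (2 * (T - t))).
Proof.
have d1 : is_derive t 1 (2 *: (cst T - id) : R -> R) (- 2).
  by apply: is_derive_eq; rewrite sub0r scalerN/= /GRing.scale/= mulr1.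
have d2 : is_derive t 1 (expR \o (2 *: (cst T - id)) - cst 1)
    (- 2 * expR (2 * (T - t))).
  by apply: is_derive_eq; rewrite subr0 mulrC.
exact: d2.
Qed.

Lemma cvg_remaining_tau (T : R) : remaining_tau T t @[t --> T^'-] --> (0 : R).
Proof.
apply: cvg_at_left_filter.
have : {for T, continuous (remaining_tau T)}.
  apply: differentiable_continuous; apply/derivable1_diffP.
  by apply: ex_derive; exact: is_derive_remaining_tau.
have tauT : remaining_tau T T = 0 by rewrite /remaining_tau subrr mulr0 expR0 subrr.
by move=> cT; rewrite -[X in _ --> X]tauT; exact: cT.
Qed.

(* The integrating factor [tau^(-1/2)] of the rate [1 / sigma^2]. *)
Definition weight (T t : R) : R := expR (- (2^-1 * ln (remaining_tau T t))).

(** The factor [expR (2 * (T - t)) / remaining_tau T t] is $\sigma_{T-t}^{-2}$. *)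
Lemma is_derive_weight (T t : R) : t < T ->
  is_derive t 1 (weight T)
    (weight T t * (expR (2 * (T - t)) / remaining_tau T t)).
Proof.
move=> tT; have tau0 := remaining_tau_gt0 tT.
have dln := is_derive1_ln tau0.
have dl := is_derive1_comp dln (is_derive_remaining_tau T t).
have d2 : is_derive t 1 (- (2^-1 *: (@ln R \o remaining_tau T)))
   (expR (2 * (T - t)) / remaining_tau T t).
  by apply: is_derive_eq; rewrite /GRing.scale/=; field; rewrite gt_eqF.
have := is_derive1_comp (is_derive_expR _) d2.
by [].
Qed.

Lemma sqr_weightV (T t : R) : t < T -> (weight T t)^-1 ^+ 2 = remaining_tau T t.
Proof.
move=> tT; rewrite /weight -expRN opprK -expRM_natl.
by rewrite mulrA mulfV ?mul1r ?lnK ?posrE ?remaining_tau_gt0.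
Qed.

(** The hypothesis says that [(f t - eta) * weight T t] is nonincreasing, and the weight tends to
    infinity at [T]. *)
Lemma comparison_at_left (T a eta delta : R) f (df : R -> R) : a < T ->
  0 < delta ->
  (forall t, a < t < T -> is_derive t 1 f (df t)) ->
  (forall t, a < t < T ->
     df t <= - ((f t - eta) * (expR (2 * (T - t)) / remaining_tau T t))) ->
  \forall t \near T^'-, f t <= eta + delta.
Proof.
(* The start is an interior point, since derivatives are given on the open interval only. *)
move=> aT d0 fd dfle; pose b := (a + T) / 2.
have ab : a < b by rewrite /b; lra.
have bT : b < T by rewrite /b; lra.
pose g t := (f t - eta) * weight T t.
pose dg t := df t * weight T t +
  (f t - eta) * (weight T t * (expR (2 * (T - t)) / remaining_tau T t)).
have gd t : a < t < T -> is_derive t 1 g (dg t).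
  move=> /[dup] atT /andP[_ tT].
  have d1 := is_deriveB (fd t atT) (is_derive_cst eta t 1).
  have := is_deriveM d1 (is_derive_weight tT).
  by move=> dm; apply: (is_derive_eq dm); rewrite /dg subr0 !fctE /GRing.scale/=; ring.
have g_le t : b <= t -> t < T -> g t <= g b.
  move=> bt tT.
  have in_at s : b <= s -> s <= t -> a < s < T.
    by move=> bs st; rewrite (lt_le_trans ab bs) (le_lt_trans st tT).
  apply: (@ler0_derive1_nincr _ g b t) => //.
  - move=> s; rewrite in_itv/= => /andP[/ltW bs /ltW st].
    by have [] := gd s (in_at _ bs st).
  - move=> s; rewrite in_itv/= => /andP[/ltW bs /ltW st].
    have D := gd s (in_at _ bs st); rewrite derive1E (@derive_val _ _ _ _ _ _ _ D).
    rewrite /dg mulrCA (mulrC (df s)) -mulrDr.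
    rewrite pmulr_rle0 ?expR_gt0// -lerBrDr sub0r.
    exact: dfle (in_at _ bs st).
  - apply: derivable_within_continuous => s; rewrite in_itv/= => /andP[bs st].
    by have [] := gd s (in_at _ bs st).
have C0 : 0 < (`|g b| + 1) by rewrite ltr_wpDl.
(* Once [remaining_tau] is below this square, the inverse weight is small enough to bring
   [g b / weight T t] below [delta]; the added 1 keeps the divisor positive. *)
have e0 : 0 < (delta / (`|g b| + 1)) ^+ 2 by rewrite exprn_gt0// divr_gt0.
near=> t.
have tT : t < T by near: t; exact: nbhs_left_lt.
have bt : b <= t by near: t; exact: nbhs_left_ge.
have W0 : 0 < weight T t by exact: expR_gt0.
have tau_le : remaining_tau T t <= (delta / (`|g b| + 1)) ^+ 2.
  near: t; exact: (cvgr_le _ (@cvg_remaining_tau T) _ e0).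
have : (weight T t)^-1 <= delta / (`|g b| + 1).
  by rewrite -(@ler_pXn2r _ 2) ?nnegrE ?sqr_weightV// ltW ?invr_gt0// divr_gt0.
rewrite ler_pdivlMr// => Wd.
have := g_le t bt tT; rewrite {1}/g -ler_pdivlMr// => fle.
rewrite addrC -lerBlDr; apply: (le_trans fle); apply: le_trans Wd.
rewrite mulrC ler_pM2l ?invr_gt0//.
by apply: (le_trans (ler_norm _)); rewrite lerDl.
Unshelve. all: by end_near. Qed.

End comparison.

(** * Differentiating the squared distance along a curve *)

Section trajectory.
Context {R : realType} {d : nat}.
Implicit Types (z : R -> 'rV[R]_d) (t : R) (v dz : 'rV[R]_d).

Lemma is_derive_coord z t dz i : is_derive t 1 z dz ->
  is_derive t 1 (fun s => z s ord0 i) (dz ord0 i).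
Proof.
move=> [dzt <-]; apply: DeriveDef; first by move/derivable_mxP : dzt; apply.
by rewrite derive_mx// mxE.
Qed.

Lemma is_derive_dot z t v dz :
  (forall i, is_derive t 1 (fun s => z s ord0 i) (dz ord0 i)) ->
  is_derive t 1 (fun s => dot v (z s)) (dot v dz).
Proof.
move=> dzi; have -> : (fun s => dot v (z s)) =
    \sum_(i < d) (v ord0 i *: (fun s => z s ord0 i)).
  by apply/funext => s; rewrite fct_sumE.
by apply: is_derive_sum => i; exact: is_deriveZ.
Qed.

Lemma is_derive_sqr_enorm_sub z t dz :
  (forall i, is_derive t 1 (fun s => z s ord0 i) (dz ord0 i)) ->
  is_derive t 1 (fun s => enorm (z s - z t) ^+ 2) 0.
Proof.
move=> dzi; have -> : (fun s => enorm (z s - z t) ^+ 2) =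
    \sum_(i < d) ((fun s => z s ord0 i) - cst (z t ord0 i)) ^+ 2.
  apply/funext => s; rewrite fct_sumE sqr_enorm; apply: eq_bigr => i _.
  by rewrite !mxE -expr2.
have -> : 0 = \sum_(i < d) (0 : R) by rewrite big1.
apply: is_derive_sum => i; have di := dzi i.
apply: is_derive_eq.
by rewrite !fctE subrr expr1 mulr0 scale0r.
Qed.

(** By [sqr_dist_expansion] the squared distance is an affine function of the curve plus a remainder
    bounded by the squared displacement, whose derivative at [t] is zero. *)
Lemma is_derive_sqr_dist (K : set 'rV[R]_d) P z t dz : is_projection K P ->
  (forall i, is_derive t 1 (fun s => z s ord0 i) (dz ord0 i)) ->
  is_derive t 1 (fun s => enorm (z s - P (z s)) ^+ 2)
    (2 * dot (z t - P (z t)) dz).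
Proof.
move=> Pp dzi; set v := z t - P (z t).
pose g s := enorm (z s - P (z s)) ^+ 2 - enorm v ^+ 2 - 2 * dot v (z s - z t).
have dg : is_derive t 1 g 0.
  apply: (is_derive0_squeeze (N := fun s => enorm (z s - z t) ^+ 2)).
  - by move=> s; exact: sqr_dist_expansion.
  - by rewrite subrr sqr_enorm -(scale0r 0) dotZl mul0r.
  - exact: is_derive_sqr_enorm_sub dzi.
have -> : (fun s => enorm (z s - P (z s)) ^+ 2) =
    g + cst (enorm v ^+ 2 - 2 * dot v (z t)) + 2 *: (fun s => dot v (z s)).
  by apply/funext => s; rewrite !fctE /g dotBr /GRing.scale/=; ring.
have dv := is_derive_dot v dzi.
by apply: is_derive_eq; rewrite !add0r.
Qed.

End trajectory.

(** * Integrability and boundedness of the data, then convergence of the trajectory *)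

Lemma density_integrable (R : realType) (d : nat) (p : 'rV[R]_d -> R) :
  is_density p -> lebesgue_integrable p.
Proof.
move=> [mp p0 p1]; apply/integrableP; split; first exact/measurable_EFinP.
under eq_integral => u _ do rewrite /= ger0_norm//.
by rewrite p1 ltry.
Qed.

Lemma compact_enorm_bounded (R : realType) (d : nat) (A : set 'rV[R]_d) :
  compact A -> exists2 B : R, 0 <= B & forall u, A u -> enorm u <= B.
Proof.
move=> cA; have [->|/set0P A0] := eqVneq A set0; first by exists 0.
have [|c _ maxc] := @compact_EVT_max _ R (fun u => dot u u) A A0 cA.
  apply: continuous_subspaceT.
  by apply: (@continuous_dot _ _ _ id id) => u; exact: cvg_id.
exists (enorm c); first exact: enorm_ge0.
move=> u /mem_set /maxc; rewrite -!sqr_enorm.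
by rewrite ler_pXn2r ?nnegrE ?enorm_ge0.
Qed.

Theorem theorem3p1 (R : realType) (d : nat) (hd : (1 <= d)%N)
  (I : finType) (eta0 : I)
  (w : I -> R) (p : I -> 'rV[R]_d -> R) (K : I -> set 'rV[R]_d)
  (w_ge0 : forall eta, 0 <= w eta)
  (w_sum1 : \sum_eta w eta = 1)
  (w_eta0 : 0 < w eta0)
  (p_density : forall eta, is_density (p eta))
  (p_supp : forall eta x, ~ K eta x -> p eta x = 0)
  (K_convex : forall eta,
    convex_set (K eta : set (convex_lmodType 'rV[R]_d)))
  (K_compact : forall eta, compact (K eta))
  (K_interior : forall eta, (K eta)° !=set0)
  (K_disjoint : forall eta eta', eta <> eta' -> K eta `&` K eta' = set0)
  (p_inf : 0 < inf [set p eta0 x | x in K eta0])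
  (T : R) (T_gt0 : 0 < T) (gamma : R) (gamma_ge1 : 1 <= gamma)
  (x0 : 'rV[R]_d) (x : R -> 'rV[R]_d)
  (x_sol : ode_solution (guided_drift w p eta0 T gamma) T x0 x) :
  edist_to (x t) (K eta0) @[t --> T^'-] --> (0 : R).
Proof.
have p_int eta : lebesgue_integrable (p eta) by exact: density_integrable.
have p_ge0 eta u : 0 <= p eta u by have [] := p_density eta.
have supp eta u : p eta u != 0 -> K eta u.
  by move=> /eqP pu; apply: contrapT => /p_supp.
have K0 : K eta0 !=set0.
  by have [c /interior_subset Kc] := K_interior eta0; exists c.
have [P Pp] := projection_exists (K_convex eta0) (K_compact eta0) K0.
have /choice[B BP] : forall eta, exists b : R,
    0 <= b /\ forall u, K eta u -> enorm u <= b.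
  by move=> eta; have [b b0 bP] := compact_enorm_bounded (K_compact eta); exists b.
(* A common bound for the finitely many supports. *)
pose b := \sum_eta B eta.
have b_ge0 : 0 <= b by apply: sumr_ge0 => eta _; have [] := BP eta.
have Kb eta u : K eta u -> enorm u <= b.
  move=> /(BP eta).2 ub; apply: (le_trans ub); rewrite /b (bigD1 eta)//= lerDl.
  by apply: sumr_ge0 => j _; have [] := BP j.
(* Twice the bound dominates all distances between support points; the added 1 makes [M] positive
   even if [b] is 0. *)
pose M := 2 * b + 1.
have M_gt0 : 0 < M by rewrite ltr_wpDl// mulr_ge0.
pose q := mixture w p.
have q_supp k u : K eta0 k -> q u != 0 -> enorm (u - k) <= M.
  move=> Kk qu; have [eta pu] : exists eta, p eta u != 0.
    apply: contrapT => h; move/negP : qu; apply; apply/eqP.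
    apply: big1 => eta _; apply/eqP; rewrite mulf_eq0; apply/orP; right.
    by apply/negPn/negP => pu; apply: h; exists eta.
  have := ler_enormD u (- k); rewrite enormN => h; apply: (le_trans h).
  by have := Kb _ _ (supp _ _ pu); have := Kb _ _ Kk; rewrite /M; lra.
have q_ge u : w eta0 * p eta0 u <= q u.
  rewrite /q /mixture (bigD1 eta0)//= lerDl.
  by apply: sumr_ge0 => eta _; rewrite mulr_ge0.
have p_ge u : K eta0 u -> inf [set p eta0 y | y in K eta0] <= p eta0 u.
  move=> Ku; apply: ge_inf; last by exists u.
  by exists 0 => _ [y _ <-].
have q_int : lebesgue_integrable q by exact: mixture_integrable.
have ppos t y : 0 < t -> 0 < ou_smooth (p eta0) t y.
  exact: (smooth_gt0 (K_convex eta0) (K_interior eta0) Pp p_inf w_eta0 M_gt0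
    (p_int eta0) (p_ge0 eta0) p_ge q_ge q_supp).
have qpos t y : 0 < t -> 0 < ou_smooth q t y.
  exact: (smooth_dominating_gt0 (K_convex eta0) (K_interior eta0) Pp p_inf
    w_eta0 M_gt0 (p_int eta0) (p_ge0 eta0) p_ge q_int q_ge q_supp).
pose z t := expR (T - t) *: x t.
have zE t : rescale (T - t) (x t) = z t by rewrite /rescale /ou_lambda expRN invrK.
pose f t := enorm (z t - P (z t)) ^+ 2.
have [_ _ dx] := x_sol.
pose drift := guided_drift w p eta0 T gamma.
(* Differentiating the factor [expR (T - t)] produces [- x t], which cancels the linear term of the
   drift. *)
pose dz t := expR (T - t) *: (drift t (x t) - x t).
have dzi t i : 0 < t < T -> is_derive t 1 (fun s => z s ord0 i) (dz t ord0 i).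
  move=> /dx dxt; have dxi := is_derive_coord i dxt.
  have de : is_derive t 1 (expR \o (cst T - id)) (- expR (T - t)).
    by apply: is_derive_eq; rewrite sub0r mulrN1.
  have -> : (fun s => z s ord0 i) =
      (expR \o (cst T - id)) * (fun s => x s ord0 i).
    by apply/funext => s; rewrite /z mxE.
  apply: is_derive_eq; rewrite /dz !mxE /GRing.scale/= !fctE.
  by rewrite /drift; ring.
have df t : 0 < t < T -> is_derive t 1 f (2 * dot (z t - P (z t)) (dz t)).
  by move=> t0T; apply: is_derive_sqr_dist Pp _ => i; exact: dzi.
have f_small (delta : R) : 0 < delta -> \forall t \near T^'-, f t <= delta.
  move=> delta0; set kp := gamma - 1.
  have kp0 : 0 <= kp by rewrite subr_ge0.
  (* The minimum with 1 gives [e ^+ 2 <= e], and the second bound then gives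
     [4 * kp ^+ 2 * e ^+ 2 <= delta / 2], also when [kp] is 0. *)
  pose e := Num.min 1 (delta / (8 * (kp ^+ 2 + 1))).
  have k1 : 0 < kp ^+ 2 + 1 by rewrite ltr_wpDl// sqr_ge0.
  have e0 : 0 < e by rewrite lt_min ltr01 divr_gt0// mulr_gt0.
  have e1 : e <= 1 by rewrite ge_min lexx.
  have e_le : e * (8 * (kp ^+ 2 + 1)) <= delta.
    by rewrite -ler_pdivlMr ?mulr_gt0// ge_min lexx orbT.
  have [A A0 AP] := guided_contraction (K_convex eta0) (K_interior eta0) Pp p_inf
    w_eta0 M_gt0 (p_int eta0) (p_ge0 eta0) (supp eta0) p_ge q_int q_ge q_supp
    gamma_ge1 e0.
  have tauA : \forall t \near T^'-, A * remaining_tau T t <= e.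
    have A1 : 0 < A + 1 by rewrite ltr_wpDl.
    have : \forall t \near T^'-, remaining_tau T t <= e / (A + 1).
      by apply: (cvgr_le _ (@cvg_remaining_tau R T)); rewrite divr_gt0.
    apply: filter_app; near=> t => h.
    have tau0 : 0 < remaining_tau T t.
      by apply: remaining_tau_gt0; near: t; exact: nbhs_left_lt.
    by move: h; rewrite ler_pdivlMr//; nra.
  (* The comparison works on an interval ending at [T]; [0 < t] is recorded because the equation is
     given at positive times. *)
  have [a aT aP] : exists2 a, a < T & forall t, a < t < T ->
      0 < t /\ A * remaining_tau T t <= e.
    have : \forall t \near T^'-, 0 < t /\ A * remaining_tau T t <= e.
      by near=> t; split; near: t => //; exact: nbhs_left_gt.
    move=> /nbhs_ballP[r /= r0 rP]; exists (T - r); first by rewrite ltrBlDr ltrDl.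
    move=> t /andP[rt tT]; apply: rP => //.
    by rewrite /ball/= gtr0_norm ?subr_gt0// ltrBlDr -ltrBlDl.
  (* The level left after completing the square: $2(D^2-2\kappa De)\ge D^2-4\kappa^2e^2$ with
     $\kappa$ standing for [kp]. *)
  pose eta := 4 * kp ^+ 2 * e ^+ 2.
  have eta_le : eta + delta / 2 <= delta.
    have : kp ^+ 2 * e ^+ 2 <= (kp ^+ 2 + 1) * e.
      by rewrite ler_pM ?sqr_ge0// ?lerDl// expr2 ler_piMl// ltW.
    by rewrite /eta; lra.
  have : \forall t \near T^'-, f t <= eta + delta / 2.
    have d2 : 0 < delta / 2 by rewrite divr_gt0.
    apply: (comparison_at_left (df := fun t => 2 * dot (z t - P (z t)) (dz t)) aT d2).
      by move=> t /[dup] /aP[t0 _] /andP[_ tT]; apply: df; rewrite t0.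
    move=> t /[dup] /aP[t0 tau_e] /andP[_ tT].
    have s0 : 0 < T - t by rewrite subr_gt0.
    set v := z t - P (z t).
    have vE : v = rescale (T - t) (x t) - P (rescale (T - t) (x t)) by rewrite zE.
    have := AP _ _ _ s0 vE.
    rewrite dotZr dotBr dot_guided_drift// => [|y|y]; [|exact: ppos|exact: qpos].
    set X := _ - _ * (smooth_dot (mixture w p) _ _ _ / _).
    have l0 := ou_lambda_gt0 (T - t); have tau0 := remaining_tau_gt0 tT.
    have eE : expR (T - t) = (ou_lambda (T - t))^-1.
      by rewrite /ou_lambda expRN invrK.
    have e2E : expR (2 * (T - t)) = (ou_lambda (T - t)) ^- 2.
      by rewrite expRM_natl eE exprVn.
    have sE : ou_sigma (T - t) ^+ 2 = ou_lambda (T - t) ^+ 2 * remaining_tau T t.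
      rewrite sqr_ou_sigma// /remaining_tau e2E mulrBr mulr1 mulfV//.
      by rewrite gt_eqF// exprn_gt0.
    rewrite -/kp sE eE e2E; move: (ou_lambda _) l0 => l l0.
    rewrite (_ : l ^+ 2 * _ / l ^+ 2 = remaining_tau T t); last first.
      by field; rewrite gt_eqF.
    move: (remaining_tau T t) tau0 tau_e => tau tau0 tau_e hX.
    rewrite /f -/v.
    (* Close to [T], [A * tau <= e], so the error [e + A * tau] is at most [2 * e]. *)
    have Dge : enorm v ^+ 2 - kp * enorm v * (2 * e) <= X / l.
      rewrite ler_pdivlMr// [leLHS]mulrC; apply: le_trans hX.
      rewrite ler_pM2l// lerD2l lerN2.
      by rewrite ler_wpM2l ?mulr_ge0 ?enorm_ge0//; lra.
    rewrite (_ : 2 * _ = - (2 * (X / l) * (l ^- 2 / tau))); last first.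
      by field; rewrite !gt_eqF.
    rewrite lerN2 ler_pM2r ?divr_gt0 ?invr_gt0 ?exprn_gt0//.
    have := sqr_ge0 (enorm v - 2 * (kp * e)); rewrite /eta; nra.
  by apply: filterS => t /le_trans; apply.
have edist_le t y : K eta0 y -> edist_to (x t) (K eta0) <= enorm (x t - y).
  move=> Ky; apply: ge_inf; last by exists y.
  by exists 0 => _ [k _ <-]; exact: enorm_ge0.
have edist_ge0 t : 0 <= edist_to (x t) (K eta0).
  apply: lb_le_inf; last by move=> _ [k _ <-]; exact: enorm_ge0.
  by have [k Kk] := K0; exists (enorm (x t - k)), k.
apply/cvgrPdist_le => /= e e0.
have eb0 : 0 < e + b by rewrite ltr_wpDr.
near=> t.
have tT : t < T by near: t; exact: nbhs_left_lt.
have ft : f t <= (e / 2) ^+ 2.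
  by near: t; apply: f_small; rewrite exprn_gt0// divr_gt0.
(* Returning from [z t] to [x t] costs at most [(T - t) * enorm (z t)]; since
   [enorm (z t) <= e + b], this choice makes it at most [e / 2]. *)
have tTe : T - t <= e / (2 * (e + b)).
  rewrite lerBlDr -lerBlDl; near: t; apply: nbhs_left_ge.
  by rewrite ltrBlDr ltrDl divr_gt0// mulr_gt0.
rewrite sub0r normrN ger0_norm//.
(* The projection of [z t], rather than of [x t], serves as the competitor in the distance from
   [x t]. *)
have [Kz _] := Pp (z t).
apply: (le_trans (edist_le t _ Kz)).
have D_le : enorm (z t - P (z t)) <= e / 2.
  by rewrite -(@ler_pXn2r _ 2) ?nnegrE ?enorm_ge0// divr_ge0 ?ltW.
have z_le : enorm (z t) <= e + b.
  rewrite -[z t](subrK (P (z t))); apply: (le_trans (ler_enormD _ _)).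
  by have := Kb _ _ Kz; lra.
have l1 : 0 <= 1 - ou_lambda (T - t) <= T - t.
  rewrite subr_ge0 ltW ?ou_lambda_lt1 ?subr_gt0//=.
  by have := expR_ge1Dx (- (T - t)); rewrite /ou_lambda; lra.
have -> : x t - P (z t) = (z t - P (z t)) + (ou_lambda (T - t) - 1) *: z t.
  rewrite scalerBl scale1r {3}/z scalerA /ou_lambda -expRD addNr expR0 scale1r.
  by apply/rowP => i; rewrite !mxE; ring.
apply: (le_trans (ler_enormD _ _)); rewrite enormZ distrC.
case/andP: l1 => l1 l2; rewrite ger0_norm//.
have : (1 - ou_lambda (T - t)) * enorm (z t) <= e / (2 * (e + b)) * (e + b).
  by rewrite ler_pM ?enorm_ge0//; exact: le_trans tTe.
rewrite (_ : e / _ * _ = e / 2); first by lra.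
by field; rewrite gt_eqF.
Unshelve. all: by end_near. Qed.
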